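(* Consider a finite MDP $\langle\mathcal S,\mathcal A,(\mathcal A(s),s\in\mathcal S),P,r\rangle$, a horizon $T\ge1$ and $\alpha\in(0,1]$. Given a policy $u\in\mathcal U^{\rm DH}$, if there exists another policy $u'\in\mathcal U^{\rm DH}$ such that $F^{u'}(s_0,\mathrm{VaR}^u(s_0))<\alpha$ for some $s_0\in\mathcal S$, then $\mathrm{VaR}^{u'}(s_0)>\mathrm{VaR}^u(s_0)$. If $F^{u'}(s_0,\mathrm{VaR}^u(s_0))<\alpha$ holds for every $s_0\in\mathcal S$, then $u'$ is a strictly improved policy, i.e. $\mathrm{VaR}^{u'}(s_0)>\mathrm{VaR}^u(s_0)$ for all $s_0\in\mathcal S$.
   Context: MDP: $\mathcal S$ and $\mathcal A$ are finite sets; $\mathcal A(s)\subseteq\mathcal A$ is the nonempty set of admissible actions in $s$, with $\cup_s\mathcal A(s)=\mathcal A$; $\mathcal K:=\{(s,a):s\in\mathcal S,a\in\mathcal A(s)\}$; $P(\cdot|s,a)$ is a probability distribution on $\mathcal S$ for each $(s,a)\in\mathcal K$; $r:\mathcal K\to\mathbb R$ is the reward function. $\mathcal U^{\rm DH}$ is the set of deterministic history-dependent policies $u=(u_t)_t$, where $u_t(h_t)\in\mathcal A(s_t)$ for each history $h_t=(s_0,a_0,\dots,s_{t-1},a_{t-1},s_t)\in\mathcal K^t\times\mathcal S$. $\mathbb P^u_{s_0}$ is the law of $(s_0,a_0,s_1,a_1,\dots)$ under $u$ started from $s_0$. $R_{0:T}:=\sum_{t=0}^{T-1}r(s_t,a_t)$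 (the terminal reward is zero); $F^u(s_0,\lambda_0):=\mathbb P^u_{s_0}(R_{0:T}\le\lambda_0)$ for $\lambda_0\in\mathbb R$; $\mathrm{VaR}^u(s_0):=\inf\{\lambda\in\mathbb R:F^u(s_0,\lambda)\ge\alpha\}$. *)

(* Defs.v *)
(* MathComp / MathComp-Analysis world. *)
From HB Require Import structures.
From mathcomp Require Import all_boot all_order all_algebra.
From mathcomp Require Import boolp classical_sets reals.

Set Implicit Arguments.
Unset Strict Implicit.
Unset Printing Implicit Defensive.

Import Order.TTheory GRing.Theory Num.Theory.

Local Open Scope ring_scope.

(* The set K of admissible state-action pairs. *)
Definition sa_pair (S A : finType) (adm : S -> {set A}) : finType :=
  {k : S * A | k.2 \in adm k.1}.

Definition sa_state (S A : finType) (adm : S -> {set A}) (k : sa_pair adm) : S :=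
  (sval k).1.

Definition sa_action (S A : finType) (adm : S -> {set A}) (k : sa_pair adm) : A :=
  (sval k).2.

Record mdp (R : realType) (S A : finType) := Mdp {
  adm : S -> {set A};
  adm_neq0 : forall s, adm s != finset.set0;
  adm_cover : (\bigcup_(s : S) adm s)%SET = [set: A]%SET;
  trans : sa_pair adm -> S -> R;                  (* P(s' | s, a) *)
  trans_ge0 : forall k s', 0 <= trans k s';
  trans_sum1 : forall k, \sum_(s' : S) trans k s' = 1;
  reward : sa_pair adm -> R
}.

Section Mdp.
Context (R : realType) (S A : finType) (M : mdp R S A).

(* h_t = (s_0, a_0, ..., s_(t-1), a_(t-1), s_t): the pairs (s_i, a_i), i < t,
   together with the current state s_t. *)
Definition history (t : nat) : finType :=
  ({ffun 'I_t -> sa_pair (adm M)} * S)%type.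

(* Deterministic history-dependent policies. *)
Record policy := Policy {
  decision : forall t, history t -> A;
  decision_adm : forall t (h : history t), decision h \in adm M h.2
}.

Definition history_state T (h : history T) (t : 'I_T.+1) : S :=
  if unlift ord_max t is Some i then sa_state (h.1 i) else h.2.

(* The history h_t contained in h_T, for t < T. *)
Definition history_prefix T (h : history T) (t : 'I_T) : history t :=
  ([ffun i : 'I_t => h.1 (widen_ord (ltnW (ltn_ord t)) i)], sa_state (h.1 t)).

(* Mass given to h_T by the law of (s_0, a_0, ..., s_(T-1), a_(T-1), s_T) under
   u started from s0; the last two factors are the probabilities of a_t given
   h_t, and of s_(t+1) given (s_t, a_t). *)
Definition history_prob (u : policy) (s0 : S) T (h : history T) : R :=
  (history_state h ord0 == s0)%:R *
  \prod_(t < T) ((sa_action (h.1 t) == decision u (history_prefix h t))%:R *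
                 trans (h.1 t) (history_state h (lift ord0 t))).

Definition Pr (u : policy) (s0 : S) T (E : pred (history T)) : R :=
  \sum_(h : history T | E h) history_prob u s0 h.

Definition total_reward T (h : history T) : R := \sum_(t < T) reward (h.1 t).

Definition cdf T (u : policy) (s0 : S) (lambda : R) : R :=
  Pr u s0 (fun h : history T => total_reward h <= lambda).

(* [inf] is real-valued, with a dummy value only on sets that are empty or not
   bounded below; for 0 < alpha <= 1 the set here is neither. *)
Definition VaR T (alpha : R) (u : policy) (s0 : S) : R :=
  inf [set lambda : R | alpha <= cdf T u s0 lambda]%classic.

End Mdp.

Arguments policy {R S A} M.
Arguments history {R S A} M t.

(* Main.v *)
Require Import Defs.
From mathcomp Require Import all_boot all_order all_algebra.
From mathcomp Require Import reals.

(* The total rewards of the finitely many histories of length T form a finite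
   set, so the distribution function of u' is constant on [L, L + e) for some
   e > 0, where L is the VaR of u.  If it is below alpha at L, it stays below
   alpha up to L + e, whence VaR of u' is at least L + e.  This needs
   {F >= alpha} to be nonempty, which holds because the history law has total
   mass 1 >= alpha. *)

Set Implicit Arguments.
Unset Strict Implicit.
Unset Printing Implicit Defensive.

Import Order.TTheory GRing.Theory Num.Theory.

Local Open Scope ring_scope.

Section HistoryLaw.
Context (R : realType) (S A : finType) (M : mdp R S A).
Implicit Types (u : policy M) (s : S).

Lemma history_prefix_trans T (h : history M T.+1) (t : 'I_T) :
  history_prefix (history_prefix h ord_max) t =
  history_prefix h (widen_ord (leqnSn T) t).
Proof.
rewrite /history_prefix /= ffunE; congr (_, sa_state (h.1 _)); last exact: ord_inj.
by apply/ffunP => i; rewrite !ffunE /=; congr (h.1 _); exact: ord_inj.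
Qed.

Lemma history_state_prefix T (h : history M T.+1) (t : 'I_T.+1) :
  history_state h (widen_ord (leqnSn _) t) =
  history_state (history_prefix h ord_max) t.
Proof.
rewrite /history_state.
have -> : widen_ord (leqnSn _) t = lift ord_max t.
  by exact/ord_inj/esym/lift_max.
rewrite liftK; case: unliftP => [j ->|->] //=.
by rewrite ffunE; congr (sa_state (h.1 _)); exact/ord_inj/lift_max.
Qed.

(** The factors with index below [T] involve only the prefix of [h], so they make up the mass of
    that prefix, and the factor of the last step splits off. *)
Lemma history_prob_recr u s0 T (h : history M T.+1) :
  history_prob u s0 h = history_prob u s0 (history_prefix h ord_max) *
    ((sa_action (h.1 ord_max) == decision u (history_prefix h ord_max))%:R *
     trans (h.1 ord_max) h.2).
Proof.
rewrite /history_prob big_ord_recr /= mulrA -history_state_prefix.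
have -> : widen_ord (leqnSn T.+1) ord0 = ord0 by exact: ord_inj.
(* This index is the last one: if it were [lift ord_max j], then [j] would have value [T.+1],
   outside ['I_T.+1]. *)
have -> : history_state h (lift ord0 ord_max) = h.2.
  rewrite /history_state; case: unliftP => // j ltE.
  by have := ltn_ord j; rewrite -(lift_max j) -ltE lift0 ltnn.
congr (_ * _ * _).
apply: eq_bigr => t _; rewrite -history_state_prefix history_prefix_trans ffunE.
have -> : widen_ord (ltnW (ltn_ord (ord_max : 'I_T.+1))) t =
  widen_ord (leqnSn T) t by exact: ord_inj.
suff -> : lift ord0 (widen_ord (leqnSn T) t) = widen_ord (leqnSn _) (lift ord0 t).
  by [].
exact: ord_inj.
Qed.

Definition policy_pair u T (h : history M T) : sa_pair (adm M) :=
  exist _ (h.2, decision u h) (decision_adm u h).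

(** The one-step continuation of [h] that obeys [u] and moves to [s]. *)
Definition extend u T (h : history M T) s : history M T.+1 :=
  ([ffun i => if unlift ord_max i is Some j then h.1 j else policy_pair u h], s).

Lemma extend_last u T (h : history M T) s :
  (extend u h s).1 ord_max = policy_pair u h.
Proof. by rewrite ffunE unlift_none. Qed.

Lemma history_prefix_extend u T (h : history M T) s :
  history_prefix (extend u h s) ord_max = h.
Proof.
rewrite /history_prefix extend_last; case: h => f s1; congr (_, _).
apply/ffunP => i; rewrite !ffunE.
have -> : widen_ord (ltnW (ltn_ord (ord_max : 'I_T.+1))) i = lift ord_max i.
  by exact/ord_inj/esym/lift_max.
by rewrite liftK.
Qed.

Lemma extendP u T (h : history M T.+1) :
  sa_action (h.1 ord_max) = decision u (history_prefix h ord_max) ->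
  extend u (history_prefix h ord_max) h.2 = h.
Proof.
move=> hact; rewrite [RHS]surjective_pairing; congr (_, _).
apply/ffunP => i; rewrite ffunE; case: unliftP => [j ->|->].
  by rewrite ffunE; congr (h.1 _); exact/ord_inj/esym/lift_max.
by apply: val_inj => /=; rewrite -hact -surjective_pairing.
Qed.

(** Induction on [T]: histories are grouped by their prefix, and within a group the transition
    probabilities out of the pair chosen by [u] sum to 1, which leaves the mass of the prefix. *)
Lemma history_prob_sum1 u s0 T : \sum_(h : history M T) history_prob u s0 h = 1.
Proof.
elim: T => [|T IHT].
  pose f0 : {ffun 'I_0 -> sa_pair (adm M)} := ffun0 (card_ord 0).
  have E (h : history M 0) : h = (f0, h.2).
    by rewrite [LHS]surjective_pairing; congr (_, _); apply/ffunP => -[].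
  have st0 (h : history M 0) : history_state h ord0 = h.2.
    by rewrite /history_state; case: unliftP => // -[].
  rewrite (bigD1 (f0, s0)) //= big1 => [|h hs].
    by rewrite /history_prob st0 eqxx big_ord0 !mul1r addr0.
  rewrite /history_prob st0; case: eqP => [h2|]; last by rewrite mul0r.
  by move: hs; rewrite [h]E h2 eqxx.
rewrite (partition_big (fun h => history_prefix h ord_max) predT) //= -IHT.
apply: eq_bigr => h _.
(* Continuations whose last action deviates from [u] have mass 0; the others are parametrized by
   their last state through [extend]. *)
rewrite (bigID (fun h' : history M T.+1 => sa_action (h'.1 ord_max) ==
  decision u (history_prefix h' ord_max))) /= [X in _ + X]big1 ?addr0; last first.
  by move=> h' /andP[_ /negPf nd]; rewrite history_prob_recr nd mul0r mulr0.
rewrite (reindex_onto (extend u h) snd) /=; last first.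
  by move=> h' /andP[/eqP <- /eqP]; exact: extendP.
transitivity (\sum_s history_prob u s0 h * trans (policy_pair u h) s); last first.
  by rewrite -mulr_sumr trans_sum1 mulr1.
apply: eq_big => [s|s _].
  by rewrite history_prefix_extend (extend_last u h s) /sa_action /= !eqxx.
rewrite history_prob_recr history_prefix_extend extend_last.
by rewrite /sa_action /= eqxx mul1r.
Qed.

Lemma history_prob_ge0 u s0 T (h : history M T) : 0 <= history_prob u s0 h.
Proof.
rewrite mulr_ge0 ?ler0n // prodr_ge0 // => t _.
by rewrite mulr_ge0 ?ler0n ?trans_ge0.
Qed.

(** Inclusion of events is assumed instead of [x <= y], so that the bound also applies when [x]
    exceeds [y] but no total reward lies in between. *)
Lemma le_cdf T u s0 (x y : R) :
  (forall h : history M T, total_reward h <= x -> total_reward h <= y) ->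
  cdf T u s0 x <= cdf T u s0 y.
Proof.
move=> xy; rewrite /cdf /Pr big_mkcond [leRHS]big_mkcond /=.
apply: ler_sum => h _; case: ifP => [/xy -> //|_].
by case: ifP; rewrite ?history_prob_ge0.
Qed.

Lemma cdf_eq1 T u s0 : exists x : R, cdf T u s0 x = 1.
Proof.
(* This sum dominates every total reward, so the event is the whole space. *)
exists (\sum_(h : history M T) `|total_reward h|).
rewrite -(history_prob_sum1 u s0 T); apply: eq_bigl => h.
by rewrite (bigD1 h) //= ler_wpDr ?ler_norm ?sumr_ge0.
Qed.

Lemma total_reward_gap T (x : R) : exists2 y : R, x < y &
  forall h : history M T, x < total_reward h -> y <= total_reward h.
Proof.
(* The least total reward above [x], capped at [x + 1], which also serves when there is none. *)
exists (\big[Order.min/x + 1]_(h : history M T | x < total_reward h)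
          total_reward h).
  by apply: lt_bigmin => //; rewrite ltrDl ltr01.
by move=> h xh; exact: bigmin_le_cond.
Qed.

Lemma lt_VaR T (alpha : R) u s0 (x : R) :
  alpha <= 1 -> cdf T u s0 x < alpha -> x < VaR T alpha u s0.
Proof.
move=> alpha1 Fx; have [y xy gap] := total_reward_gap T x.
apply: (lt_le_trans xy); apply: lb_le_inf.
  (* Nonemptiness rules out the dummy value of [inf]. *)
  by have [z Fz] := cdf_eq1 T u s0; exists z; rewrite /= Fz.
(* If [z < y], a total reward at most [z] cannot exceed [x], so the distribution function at [z] is
   at most its value at [x], below [alpha]. *)
move=> z /= Fz; rewrite leNgt; apply/negP => zy.
have := lt_le_trans Fx Fz; rewrite ltNge le_cdf // => h hz.
rewrite leNgt; apply/negP => /gap yh.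
by have := le_lt_trans (le_trans yh hz) zy; rewrite ltxx.
Qed.

End HistoryLaw.

Theorem corollary1 (R : realType) (S A : finType) (M : mdp R S A)
    (T : nat) (hT : (1 <= T)%N) (alpha : R)
    (halpha0 : 0 < alpha) (halpha1 : alpha <= 1) (u u' : policy M) :
  (forall s0 : S, cdf T u' s0 (VaR T alpha u s0) < alpha ->
     VaR T alpha u s0 < VaR T alpha u' s0) /\
  ((forall s0 : S, cdf T u' s0 (VaR T alpha u s0) < alpha) ->
     forall s0 : S, VaR T alpha u s0 < VaR T alpha u' s0).
Proof. by split=> [s0 Fs0|F s0]; apply: lt_VaR. Qed.
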